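(* Let $\mathcal{X}$ and $\mathcal{Y}$ be Euclidean mm-spaces in the same ambient space $\mathbb{R}^n$, let $p\geq1$ and let $M=\max\{\mathrm{diam}(X),\mathrm{diam}(Y)\}$. Then $$d^{\mathrm{emb}}_{\mathrm{GM},p}(\mathcal{X},\mathcal{Y})\leq d^{\mathbb{R}^n}_{\mathrm{M},p,\mathrm{iso}}(\mathcal{X},\mathcal{Y})\leq M^{1/2}\cdot c_n\cdot\big(d^{\mathrm{emb}}_{\mathrm{GM},p}(\mathcal{X},\mathcal{Y})\big)^{1/2},$$ where $c_n$ is a constant depending only on $n$.
   Context: A metric measure space (mm-space) is a triple $(X,d_X,\mu_X)$ with $(X,d_X)$ a compact metric space and $\mu_X$ a Borel probability measure of full support. A Euclidean mm-space is an mm-space with $X$ a (compact) subset of some $\mathbb{R}^n$ and $d_X$ the restriction of the Euclidean distance (no condition on $\mu_X$ beyond full support). For Borel probability measures $\alpha,\beta$, $\mathcal{T}(\alpha,\beta)$ is the set of measurable maps $\phi$ with $\phi_\#\alpha=\beta$. For a compact metric space $Z$, $d^Z_{\mathrm{M},p}(\alpha,\beta)=\inf_{\phi\in\mathcal{T}(\alpha,\beta)}\left(\int_Z d_Z(z,\phi(z))^p\,\alpha(dz)\right)^{1/p}$ ($=\infty$ if $\mathcal{T}(\alpha,\beta)=\emptyset$), and $d^{\mathrm{emb}}_{\mathrm{GM},p}(\mathcal{X},\mathcal{Y})=\inf_{Z,\phi_X,\phi_Y}d^Z_{\mathrm{M},p}((\phi_X)_\#\mu_X,(\phi_Y)_\#\mu_Y)$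 over compact metric spaces $Z$ and isometric embeddings $\phi_X:X\to Z$, $\phi_Y:Y\to Z$. With $E(n)$ the group of Euclidean isometries of $\mathbb{R}^n$ and $\|\cdot\|$ the Euclidean norm, the isometry-invariant Monge $p$-distance is $$d^{\mathbb{R}^n}_{\mathrm{M},p,\mathrm{iso}}(\mathcal{X},\mathcal{Y})=\inf_{T\in E(n)}\left(\inf_{\phi\in\mathcal{T}(\mu_X,\mu_Y)}\int_X\|T(x)-\phi(x)\|^p\,\mu_X(dx)\right)^{1/p}.$$ *)

(* Defs.v *)
From HB Require Import structures.
From mathcomp Require Import all_boot all_order all_algebra.
From mathcomp Require Import all_classical all_reals all_analysis.
Set Implicit Arguments. Unset Strict Implicit. Unset Printing Implicit Defensive.
Import Order.TTheory GRing.Theory Num.Theory.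
Local Open Scope classical_set_scope.
Local Open Scope ring_scope.

(** R^n (row vectors) is nonempty: pointed by 0, as required of
    measurable spaces in MathComp-Analysis. *)
Definition vec (R : realType) (n : nat) := 'rV[R]_n.
HB.instance Definition _ (R : realType) n := GRing.Zmodule.on (vec R n).
HB.instance Definition _ (R : realType) n :=
  isPointed.Build (vec R n) (0 : 'rV[R]_n).

Section Defs.
Variable R : realType.

Definition is_metric {T : Type} (d : T -> T -> R) : Prop :=
  [/\ (forall x y, 0 <= d x y),
      (forall x y, d x y = 0 <-> x = y),
      (forall x y, d x y = d y x) &
      (forall x y z, d x z <= d x y + d y z)].

Definition dball {T : Type} (d : T -> T -> R) (x : T) (r : R) : set T :=
  [set y | d x y < r].

Definition dopen {T : Type} (d : T -> T -> R) (A : set T) : Prop :=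
  forall x, A x -> exists2 r : R, 0 < r & dball d x r `<=` A.

Definition dcompact {T : Type} (d : T -> T -> R) (A : set T) : Prop :=
  forall (I : Type) (F : I -> set T), (forall i, dopen d (F i)) ->
    A `<=` \bigcup_(i in setT) F i ->
    exists J : set I, finite_set J /\ A `<=` \bigcup_(i in J) F i.

Definition borel_of {T : pointedType} (d : T -> T -> R) :=
  g_sigma_algebraType (dopen d).

Definition edist (n : nat) (x y : vec R n) : R :=
  Num.sqrt (\sum_(i < n) (x ord0 i - y ord0 i) ^+ 2).

Definition Rn (n : nat) := borel_of (@edist n).

Definition diam (n : nat) (X : set (vec R n)) : R :=
  sup [set r | exists x y, [/\ X x, X y & r = edist x y]].

(** A Euclidean mm-space (X, |.|, mu_X) in R^n: X compact, mu_X a Borel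
    probability measure on R^n concentrated on X (i.e. a Borel probability
    measure on X) with full support on X. *)
Definition euclid_mm (n : nat) (X : set (vec R n)) (mu : probability (Rn n) R)
  : Prop :=
  [/\ dcompact (@edist n) X,
      mu X = 1%E &
      forall x, X x -> forall r : R, 0 < r ->
        (0 < mu (X `&` dball (@edist n) x r))%E].

Definition eisometry (n : nat) (T : vec R n -> vec R n) : Prop :=
  forall x y, edist (T x) (T y) = edist x y.

Definition isom_embedding (n : nat) (X : set (vec R n)) {Z : Type}
  (dZ : Z -> Z -> R) (f : vec R n -> Z) : Prop :=
  forall x y, X x -> X y -> dZ (f x) (f y) = edist x y.

(** Monge p-distance d^Z_{M,p}(alpha, beta) on a metric space (Z, dZ);
    ereal_inf of the empty set is +oo. *)
Definition dMonge {Z : pointedType} (dZ : Z -> Z -> R) (p : R)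
  (alpha beta : probability (borel_of dZ) R) : \bar R :=
  ereal_inf [set v | exists phi : borel_of dZ -> borel_of dZ,
    [/\ measurable_fun setT phi,
        (forall B : set (borel_of dZ), measurable B ->
           alpha (phi @^-1` B) = beta B) &
        v = ((\int[alpha]_z ((dZ z (phi z)) `^ p)%:E) `^ p^-1)%E]].

Definition dGM_emb (n : nat) (p : R)
  (X : set (vec R n)) (muX : probability (Rn n) R)
  (Y : set (vec R n)) (muY : probability (Rn n) R) : \bar R :=
  ereal_inf [set v | exists (Z : pointedType) (dZ : Z -> Z -> R)
      (fX fY : vec R n -> Z) (alpha beta : probability (borel_of dZ) R),
    [/\ is_metric dZ /\ dcompact dZ setT,
        isom_embedding X dZ fX /\ isom_embedding Y dZ fY,
        (forall A : set (borel_of dZ), measurable A ->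
           alpha A = muX (X `&` fX @^-1` A)),
        (forall A : set (borel_of dZ), measurable A ->
           beta A = muY (Y `&` fY @^-1` A)) &
        v = dMonge p alpha beta]].

Definition monge_cost_iso (n : nat) (p : R) (T : vec R n -> vec R n)
  (X : set (vec R n)) (muX : probability (Rn n) R)
  (muY : probability (Rn n) R) : \bar R :=
  ereal_inf [set w | exists phi : Rn n -> Rn n,
    [/\ measurable_fun setT phi,
        (forall B : set (Rn n), measurable B ->
           muX (phi @^-1` B) = muY B) &
        w = (\int[muX]_(x in X) ((edist (T x) (phi x)) `^ p)%:E)%E]].

Definition dM_iso (n : nat) (p : R)
  (X : set (vec R n)) (muX : probability (Rn n) R)
  (Y : set (vec R n)) (muY : probability (Rn n) R) : \bar R :=
  ereal_inf [set v | exists T : vec R n -> vec R n, eisometry T /\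
    v = ((monge_cost_iso p T X muX muY) `^ p^-1)%E].

End Defs.

(* Main.v *)
(** For the first inequality, take the compact set [T(X) \cup Y] as the common
    space [Z].

    For the second, a Monge map [phi] on [Z] pairs points [u] of [X] with points
    [v] of [Y], and if [D = d_Z(z, phi z)] is the displacement, distances between
    two [u]'s and the corresponding [v]'s differ by at most [D + D'].  Centre
    both configurations at a pair whose displacement is at most [e > ||D||_p].
    By polarization the Gram matrices of the centred configurations differ by at
    most [U U'], where [U] is a multiple of [sqrt (M / e) (D + 2 e)].  Such a
    product bound forces the two configurations to be congruent up to [C_n U]
    pointwise, and [||U||_p] is of order [sqrt (M e)]. *)
Require Import Defs.
From HB Require Import structures.
From mathcomp Require Import all_boot all_order all_algebra.
From mathcomp Require Import all_classical all_reals all_analysis.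
From mathcomp Require Import measurable_realfun ring lra.
Import Order.TTheory GRing.Theory Num.Theory.
(* [all_analysis] shadows [Defs.edist]. *)
Import Defs.
Local Open Scope classical_set_scope.
Local Open Scope ring_scope.

(** * Rigidity of Gram matrices *)

(** The displacement [D] is small only in L^p and may be large at some points, so a rigidity
    statement with one uniform error would not suffice. The weight [U] lets the error vary from
    point to point: Gram entries that agree up to [U x * U y] give an alignment within [C * U x] at
    [x], and such a bound can be raised to the power [p] and integrated. The additive Gram error
    [2M (D s + D t + 2e)] becomes a product through [e (D s + D t + 2e) <= (D s + 2e) (D t + 2e)].
    The division by [e], weighed against an L^p norm of order [e] for [D + 2e], is what leaves a
    square root in the estimate. All this needs [M > 0] and [e > 0]: one-point spaces are treated
    apart, and [e] tends to the embedding distance at the end. As to measures, an embedding into [Z]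
    is controlled on [X] or [Y] only, so it is replaced by a measurable map with a default value
    elsewhere. *)

Section DotProduct.
Variable R : realType.

Definition dot (n : nat) (u v : 'rV[R]_n) : R := (u *m v^T) 0 0.
Definition enorm (n : nat) (u : 'rV[R]_n) : R := Num.sqrt (dot n u u).
Arguments dot {n}.
Arguments enorm {n}.

Lemma dotE n (u v : 'rV[R]_n) : dot u v = \sum_i u 0 i * v 0 i.
Proof. by rewrite /dot mxE; apply: eq_bigr => i _; rewrite mxE. Qed.

Lemma dotC n (u v : 'rV[R]_n) : dot u v = dot v u.
Proof. by rewrite !dotE; apply: eq_bigr => i _; rewrite mulrC. Qed.

Lemma dotDl n (u v w : 'rV[R]_n) : dot (u + v) w = dot u w + dot v w.
Proof. by rewrite /dot mulmxDl mxE. Qed.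

Lemma dotZl n a (u w : 'rV[R]_n) : dot (a *: u) w = a * dot u w.
Proof. by rewrite /dot -scalemxAl mxE. Qed.

Lemma dotNl n (u w : 'rV[R]_n) : dot (- u) w = - dot u w.
Proof. by rewrite /dot mulNmx mxE. Qed.

Lemma dotDr n (u v w : 'rV[R]_n) : dot w (u + v) = dot w u + dot w v.
Proof. by rewrite dotC dotDl !(dotC _ w). Qed.

Lemma dotZr n a (u w : 'rV[R]_n) : dot w (a *: u) = a * dot w u.
Proof. by rewrite dotC dotZl (dotC _ w). Qed.

Lemma dotNr n (u w : 'rV[R]_n) : dot w (- u) = - dot w u.
Proof. by rewrite dotC dotNl (dotC _ w). Qed.

Definition dot_linear := (dotDl, dotDr, dotNl, dotNr, dotZl, dotZr).

Lemma dot_ge0 n (u : 'rV[R]_n) : 0 <= dot u u.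
Proof. by rewrite dotE; apply: sumr_ge0 => i _; rewrite -expr2 sqr_ge0. Qed.

Lemma dot_eq0 n (u : 'rV[R]_n) : dot u u = 0 -> u = 0.
Proof.
rewrite dotE => /eqP; rewrite psumr_eq0; last by move=> i _; rewrite -expr2 sqr_ge0.
move=> /allP u0; apply/rowP => i; rewrite mxE.
by have /eqP := u0 i (mem_index_enum _) => /eqP; rewrite mulf_eq0 orbb => /eqP.
Qed.

Lemma enorm_ge0 n (u : 'rV[R]_n) : 0 <= enorm u.
Proof. exact: sqrtr_ge0. Qed.

Lemma enorm_sqr n (u : 'rV[R]_n) : enorm u ^+ 2 = dot u u.
Proof. by rewrite /enorm sqr_sqrtr // dot_ge0. Qed.

Lemma enormN n (u : 'rV[R]_n) : enorm (- u) = enorm u.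
Proof. by rewrite /enorm !dot_linear opprK. Qed.

Lemma enorm_eq0 n (u : 'rV[R]_n) : enorm u = 0 -> u = 0.
Proof. by move=> u0; apply: dot_eq0; rewrite -enorm_sqr u0 expr0n. Qed.

Lemma dot_CauchySchwarz n (u v : 'rV[R]_n) : `|dot u v| <= enorm u * enorm v.
Proof.
rewrite -(@ler_pXn2r _ 2) ?nnegrE ?mulr_ge0 ?enorm_ge0//.
rewrite exprMn !enorm_sqr real_normK ?num_real//.
have [v0|vn0] := eqVneq (dot v v) 0.
  by rewrite (dot_eq0 n v v0) /dot trmx0 !mulmx0 mxE expr0n mulr0.
have vp : 0 < dot v v by rewrite lt0r vn0 dot_ge0.
have := dot_ge0 n (dot v v *: u - dot u v *: v).
rewrite !dot_linear (dotC _ v u) => h.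
rewrite -subr_ge0 -(pmulr_rge0 _ vp); lra.
Qed.

Lemma enormD n (u v : 'rV[R]_n) : enorm (u + v) <= enorm u + enorm v.
Proof.
rewrite -(@ler_pXn2r _ 2) ?nnegrE ?addr_ge0 ?enorm_ge0//.
rewrite enorm_sqr !dot_linear sqrrD !enorm_sqr (dotC _ v u).
have := le_trans (ler_norm _) (dot_CauchySchwarz n u v); lra.
Qed.

Lemma enorm_sub n (u v : 'rV[R]_n) : enorm (u - v) <= enorm u + enorm v.
Proof. by rewrite (le_trans (enormD _ _ _))// enormN. Qed.

Lemma dot_row_mx m n (a c : 'rV[R]_m) (b d : 'rV[R]_n) :
  dot (row_mx a b) (row_mx c d) = dot a c + dot b d.
Proof. by rewrite /dot tr_row_mx mul_row_col mxE. Qed.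

Definition orthogonal_mx n (P : 'M[R]_n) := P *m P^T = 1%:M.

Lemma dot_orthogonal n (P : 'M[R]_n) (u v : 'rV[R]_n) :
  orthogonal_mx n P -> dot (u *m P) (v *m P) = dot u v.
Proof. by move=> hP; rewrite /dot trmx_mul mulmxA -(mulmxA u) hP mulmx1. Qed.

Lemma orthogonal_mxM n (P Q : 'M[R]_n) :
  orthogonal_mx n P -> orthogonal_mx n Q -> orthogonal_mx n (P *m Q).
Proof.
by move=> hP hQ; rewrite /orthogonal_mx trmx_mul mulmxA -(mulmxA P) hQ mulmx1.
Qed.

Lemma orthogonal_mx1 n : orthogonal_mx n 1%:M.
Proof. by rewrite /orthogonal_mx trmx1 mulmx1. Qed.

Lemma orthogonal_mxT n (P : 'M[R]_n) : orthogonal_mx n P -> orthogonal_mx n P^T.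
Proof. by rewrite /orthogonal_mx trmxK => /mulmx1C. Qed.

Lemma orthogonal_block n (P : 'M[R]_n) : orthogonal_mx n P ->
  orthogonal_mx (1 + n) (block_mx 1%:M 0 0 P).
Proof.
move=> hP; rewrite /orthogonal_mx tr_block_mx !trmx0 trmx1 mulmx_block.
by rewrite !mulmx0 !mul0mx !addr0 add0r mulmx1 hP -scalar_mx_block.
Qed.

(* The Householder reflection along u - |u| e_1. *)
Lemma rotate_to_axis n (u : 'rV[R]_(1 + n)) : exists P : 'M[R]_(1 + n),
  orthogonal_mx _ P /\ u *m P = row_mx (enorm u)%:M 0.
Proof.
set w : 'rV[R]_(1 + n) := row_mx (enorm u)%:M 0.
have ww : dot w w = dot u u.
  rewrite -[RHS]enorm_sqr dot_row_mx {2}/dot mul0mx [X in _ + X]mxE addr0.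
  by rewrite dotE big_ord1 mxE mulr1n expr2.
set v := u - w.
have [v0|vn0] := eqVneq (dot v v) 0.
  exists 1%:M; split; first exact: orthogonal_mx1.
  by rewrite mulmx1; apply/eqP; rewrite -subr_eq0; apply/eqP; exact: dot_eq0.
(* Since [u] and [w] have the same norm, [v.v = 2 u.v]; the reflection then subtracts exactly [v]
   from [u], leaving [w]. *)
have vE : dot v v = dot u v *+ 2.
  by rewrite /v !dot_linear ww (dotC _ w u) mulr2n; ring.
exists (1%:M - (2 / dot v v) *: (v^T *m v)); split.
  rewrite /orthogonal_mx; set S := v^T *m v; set c := 2 / _.
  have ST : S^T = S by rewrite /S trmx_mul trmxK.
  have SS : S *m S = dot v v *: S.
    rewrite /S mulmxA -(mulmxA v^T) [v *m v^T]mx11_scalar -/(dot v v).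
    by rewrite mul_mx_scalar -scalemxAl.
  have -> : (1%:M - c *: S)^T = 1%:M - c *: S.
    by rewrite linearB /= linearZ /= ST trmx1.
  rewrite mulmxBl mul1mx mulmxBr mulmx1 -scalemxAl -scalemxAr SS !scalerA.
  by rewrite /c -mulrA divfK//; apply/matrixP => i k; rewrite !mxE; ring.
rewrite mulmxBr mulmx1 -scalemxAr mulmxA [u *m v^T]mx11_scalar -/(dot u v).
rewrite mul_scalar_mx scalerA vE.
have d0 : dot u v != 0 by apply: contraNN vn0 => /eqP d; rewrite vE d mul0rn.
have -> : 2 / (dot u v *+ 2) * dot u v = 1 by field; rewrite d0.
by rewrite scale1r /v opprB addrCA subrr addr0.
Qed.

Lemma orthogonal_enorm n (P : 'M[R]_n) (u : 'rV[R]_n) :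
  orthogonal_mx n P -> enorm (u *m P) = enorm u.
Proof. by move=> hP; rewrite /enorm dot_orthogonal. Qed.

(** The supremum of [r] need not be attained. A value within [sup - c] of it exceeds [c], and one
    within [sup / 2] is at least half of it. *)
Lemma near_max (T : Type) (r : T -> R) (B c : R) (x0 : T) :
  0 < c -> c < r x0 -> (forall x, r x <= B) ->
  exists x1, c < r x1 /\ forall x, r x <= 2 * r x1.
Proof.
move=> c0 cx0 rB; pose S := [set r x | x in [set: T]].
have supS : has_sup S.
  by split; [exists (r x0), x0|exists B => _ [x _ <-]].
have rS x : r x <= sup S.
  by apply: sup_upper_bound => //; exists x.
have S0 : 0 < sup S by rewrite (lt_trans c0)// (lt_le_trans cx0).
have e0 : 0 < Num.min (sup S - c) (sup S / 2).
  by rewrite lt_min subr_gt0 (lt_le_trans cx0)//= divr_gt0.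
have [_ [x1 _ <-]] := sup_adherent e0 supS.
rewrite ltrBlDr -ltrBlDl => h; have := rS x1 => h1.
have [m1 m2] : Num.min (sup S - c) (sup S / 2) <= sup S - c /\
  Num.min (sup S - c) (sup S / 2) <= sup S / 2.
  by rewrite !ge_min !lexx orbT.
exists x1; split; first lra.
by move=> x; have := rS x; lra.
Qed.

(** Here [L] and [b] stand for [|f x1| / U x1] and [|g x1| / U x1]. Split [L (f1 - g1)] as
    [(f1 L - g1 b) + g1 (b - L)]. Since [b + L >= L], the hypothesis on squares gives
    [|b - L| <= 1 / L], so the second term is at most [(2L + 1) U / L <= 3 U]. *)
Lemma axis_coordinates_close (L b U f1 g1 : R) :
  4 < L -> 0 <= b -> 0 <= U -> `|L ^+ 2 - b ^+ 2| <= 1 ->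
  `|f1 * L - g1 * b| <= U -> `|g1| <= (2 * L + 1) * U ->
  L * `|f1 - g1| <= 4 * U.
Proof.
move=> L4 b0 U0 Lb fg g1U.
have L0 : 0 < L by lra.
have hb : L * `|b - L| <= 1.
  apply: le_trans Lb; rewrite subr_sqr normrM distrC mulrC ler_wpM2l//.
  by rewrite ger0_norm; lra.
have -> : L * `|f1 - g1| = `|(f1 * L - g1 * b) + g1 * (b - L)|.
  by rewrite -[X in X * _ = _](ger0_norm (ltW L0)) -normrM; congr (`|_|); ring.
rewrite (le_trans (ler_normD _ _))// normrM.
have : `|g1| * `|b - L| <= 3 * U; last by lra.
have : `|g1| * `|b - L| <= (2 * L + 1) * U * `|b - L| by rewrite ler_wpM2r.
move/le_trans; apply.
have : 3 * U * (L * `|b - L|) <= 3 * U * 1 by rewrite ler_wpM2l//; lra.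
rewrite mulr1; apply: le_trans.
have : 0 <= (L - 1) * (U * `|b - L|) by rewrite !mulr_ge0//; lra.
lra.
Qed.

(* The point x1 nearly maximising |f| / U provides the first axis: once both
   configurations are rotated so that f x1 and g x1 lie on it, the remaining
   coordinates satisfy the same hypothesis with a larger multiple of U. *)
Lemma gram_rigidity n : exists2 C : R, 0 < C &
  forall (T : Type) (f g : T -> 'rV[R]_n) (U : T -> R) (B : R),
    (forall x, 0 < U x) -> (forall x, enorm (f x) <= B * U x) ->
    (forall x y, `|dot (f x) (f y) - dot (g x) (g y)| <= U x * U y) ->
    exists P Q : 'M[R]_n, [/\ orthogonal_mx n P, orthogonal_mx n Q &
      forall x, enorm (f x *m P - g x *m Q) <= C * U x].
Proof.
elim: n => [|n [C C0 IH]].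
  exists 1 => // T f g U B U0 _ _; exists 1%:M, 1%:M; split; try exact: orthogonal_mx1.
  move=> x; rewrite [_ - _]thinmx0 /enorm /dot mul0mx mxE sqrtr0 mul1r.
  exact: ltW.
(* The 9 is [4 + 5], from [|f| <= 4 U] and [|g| <= 5 U] when no axis is long; [5 C] comes from the
   induction hypothesis with weight [5 U]. *)
exists (9 + 5 * C); first by lra.
move=> T f g U B U0 fB fg.
have gU x : enorm (g x) <= enorm (f x) + U x.
  rewrite -(@ler_pXn2r _ 2) ?nnegrE ?addr_ge0 ?enorm_ge0//; last exact: ltW.
  rewrite sqrrD !enorm_sqr.
  have := fg x x; rewrite ler_norml => /andP[h _].
  have := mulr_ge0 (enorm_ge0 _ (f x)) (ltW (U0 x)); rewrite -expr2 in h; lra.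
have [small|] := pselect (forall x, enorm (f x) / U x <= 4).
  exists 1%:M, 1%:M; split; try exact: orthogonal_mx1.
  move=> x; rewrite !mulmx1 (le_trans (enorm_sub _ _ _))//.
  have := small x; rewrite ler_pdivrMr// => f4.
  have := gU x; have := mulr_gt0 C0 (U0 x); lra.
move=> /existsNP[x0 /negP]; rewrite -ltNge => x04.
have fUB x : enorm (f x) / U x <= B by rewrite ler_pdivrMr.
(* The bound [B] serves to make this supremum finite; it does not enter the constant. *)
have [x1 []] := @near_max _ (fun x => enorm (f x) / U x) B 4 x0 (ltr0Sn _ _) x04 fUB.
set L := enorm (f x1) / U x1 => L4 fL'.
have L0 : 0 < L by lra.
have fL x : enorm (f x) <= 2 * L * U x by rewrite -ler_pdivrMr.
have {}gU x : enorm (g x) <= (2 * L + 1) * U x.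
  by rewrite (le_trans (gU x))// mulrDl mul1r lerD2r.
have [P1 [oP1 fP1]] := rotate_to_axis n (f x1).
have [Q1 [oQ1 gQ1]] := rotate_to_axis n (g x1).
pose f1 x := lsubmx (f x *m P1 : 'rV_(1 + n)) 0 0.
pose f' x := rsubmx (f x *m P1 : 'rV_(1 + n)).
pose g1 x := lsubmx (g x *m Q1 : 'rV_(1 + n)) 0 0.
pose g' x := rsubmx (g x *m Q1 : 'rV_(1 + n)).
have fE x : f x *m P1 = row_mx (f1 x)%:M (f' x).
  by rewrite -[LHS]hsubmxK; congr row_mx; apply: mx11_scalar.
have gE x : g x *m Q1 = row_mx (g1 x)%:M (g' x).
  by rewrite -[LHS]hsubmxK; congr row_mx; apply: mx11_scalar.
have dot1 (a b : R) : dot (a%:M : 'rV[R]_1) b%:M = a * b.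
  by rewrite dotE big_ord1 !mxE !mulr1n.
have fdot x y : dot (f x) (f y) = f1 x * f1 y + dot (f' x) (f' y).
  by rewrite -(dot_orthogonal _ _ _ _ oP1) !fE dot_row_mx dot1.
have gdot x y : dot (g x) (g y) = g1 x * g1 y + dot (g' x) (g' y).
  by rewrite -(dot_orthogonal _ _ _ _ oQ1) !gE dot_row_mx dot1.
have fx1 x : dot (f x) (f x1) = f1 x * enorm (f x1).
  by rewrite -(dot_orthogonal _ _ _ _ oP1) fP1 fE dot_row_mx dot1 /dot
    trmx0 mulmx0 mxE addr0.
have gx1 x : dot (g x) (g x1) = g1 x * enorm (g x1).
  by rewrite -(dot_orthogonal _ _ _ _ oQ1) gQ1 gE dot_row_mx dot1 /dot
    trmx0 mulmx0 mxE addr0.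
have f1f x : `|f1 x| <= enorm (f x).
  rewrite -(@ler_pXn2r _ 2) ?nnegrE ?enorm_ge0// enorm_sqr fdot real_normK ?num_real//.
  by rewrite expr2 lerDl dot_ge0.
have g1g x : `|g1 x| <= enorm (g x).
  rewrite -(@ler_pXn2r _ 2) ?nnegrE ?enorm_ge0// enorm_sqr gdot real_normK ?num_real//.
  by rewrite expr2 lerDl dot_ge0.
have f'f x : enorm (f' x) <= enorm (f x).
  rewrite -(@ler_pXn2r _ 2) ?nnegrE ?enorm_ge0// !enorm_sqr fdot.
  by rewrite lerDr -expr2 sqr_ge0.
have u0 := U0 x1.
have Uge0 x : 0 <= U x by exact: ltW.
have fx1E : enorm (f x1) = L * U x1 by rewrite /L divfK ?gt_eqF.
clearbody L.
have close x : L * `|f1 x - g1 x| <= 4 * U x.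
  apply: (@axis_coordinates_close L (enorm (g x1) / U x1)) => //.
  - by rewrite divr_ge0 ?enorm_ge0 ?ltW.
  - have := fg x1 x1; rewrite -(enorm_sqr _ (f x1)) fx1E => h.
    rewrite -(@ler_pM2r _ (U x1 ^+ 2)) ?exprn_gt0// mul1r.
    rewrite -[X in _ * X <= _](@ger0_norm _ (U x1 ^+ 2)) ?sqr_ge0// -normrM.
    rewrite mulrBl exprMn exprVn enorm_sqr divfK ?expf_neq0 ?gt_eqF//.
    by rewrite -exprMn [leRHS]expr2.
  - have := fg x x1; rewrite fx1 gx1 fx1E => h.
    rewrite -(@ler_pM2r _ (U x1))//.
    rewrite -[X in _ * X <= _](@ger0_norm _ (U x1)) ?(ltW u0)// -normrM.
    by rewrite mulrBl -!mulrA mulVf ?mulr1 ?gt_eqF.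
  - exact: le_trans (g1g x) (gU x).
(* Axis coordinates have size of order [L U] and differ by at most [4 U / L], so [L] cancels in the
   products. The total is [1 + 8 + 12 = 21], below [5 * 5]. *)
have residual x y :
    `|dot (f' x) (f' y) - dot (g' x) (g' y)| <= (5 * U x) * (5 * U y).
  have -> : dot (f' x) (f' y) - dot (g' x) (g' y) =
      (dot (f x) (f y) - dot (g x) (g y)) -
      ((f1 x - g1 x) * f1 y + g1 x * (f1 y - g1 y)).
    by rewrite fdot gdot; ring.
  rewrite (le_trans (ler_normB _ _))//.
  have h1 : `|(f1 x - g1 x) * f1 y| <= 8 * (U x * U y).
    rewrite normrM (@le_trans _ _ (`|f1 x - g1 x| * (2 * L * U y)))//.
      by rewrite ler_wpM2l// (le_trans (f1f y)) ?fL.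
    have : L * `|f1 x - g1 x| * (2 * U y) <= 4 * U x * (2 * U y).
      by rewrite ler_wpM2r ?mulr_ge0 ?Uge0 ?close.
    lra.
  have h2 : `|g1 x * (f1 y - g1 y)| <= 12 * (U x * U y).
    rewrite normrM (@le_trans _ _ ((3 * L * U x) * `|f1 y - g1 y|))//.
      rewrite ler_wpM2r// (le_trans (g1g x))// (le_trans (gU x))//.
      by rewrite ler_pM2r//; lra.
    have : L * `|f1 y - g1 y| * (3 * U x) <= 4 * U y * (3 * U x).
      by rewrite ler_wpM2r ?mulr_ge0 ?Uge0 ?close.
    lra.
  have := fg x y.
  have := ler_normD ((f1 x - g1 x) * f1 y) (g1 x * (f1 y - g1 y)).
  have := mulr_gt0 (U0 x) (U0 y); lra.
have [||P' [Q' [oP' oQ' hPQ]]] := IH T f' g' (fun x => 5 * U x) (`|B|) _ _ residual.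
- by move=> x; rewrite mulr_gt0.
- move=> x; rewrite (le_trans (f'f x))// (le_trans (fB x))//.
  have : B * U x <= `|B| * U x by rewrite ler_pM2r// ler_norm.
  have := mulr_ge0 (normr_ge0 B) (ltW (U0 x)); lra.
exists (P1 *m block_mx (1%:M : 'M[R]_1) 0 0 P'),
  (Q1 *m block_mx (1%:M : 'M[R]_1) 0 0 Q').
split; try by apply: orthogonal_mxM => //; exact: orthogonal_block.
have blockE (a : 'rV[R]_1) (v : 'rV_n) (S : 'M[R]_n) :
    row_mx a v *m block_mx 1%:M 0 0 S = row_mx a (v *m S).
  by rewrite mul_row_block !mulmx0 mulmx1 addr0 add0r.
have subE (a c : R) (v w : 'rV[R]_n) :
    enorm ((row_mx a%:M v : 'rV_(1 + n)) - row_mx c%:M w) ^+ 2 =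
    (a - c) ^+ 2 + enorm (v - w) ^+ 2.
  by rewrite opp_row_mx add_row_mx -raddfB enorm_sqr dot_row_mx dot1 -expr2 enorm_sqr.
move=> x; rewrite !mulmxA fE gE.
rewrite (blockE (f1 x)%:M (f' x) P') (blockE (g1 x)%:M (g' x) Q').
rewrite -(@ler_pXn2r _ 2) ?nnegrE ?enorm_ge0//; last first.
  by rewrite mulr_ge0 ?ltW// addr_gt0 ?mulr_gt0.
rewrite [leLHS](subE _ _ _ _).
(* With [L > 4], the bound [close] leaves an error of at most [U x] along the axis. *)
have h1 : (f1 x - g1 x) ^+ 2 <= U x ^+ 2.
  rewrite -[X in X <= _]real_normK ?num_real// ler_pXn2r ?nnegrE//.
  by rewrite -(@ler_pM2l _ 4)// (le_trans _ (close x))// ler_wpM2r// ltW.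
have h2 : enorm (f' x *m P' - g' x *m Q') ^+ 2 <= (5 * C * U x) ^+ 2.
  rewrite ler_pXn2r ?nnegrE ?enorm_ge0 ?mulr_ge0 ?Uge0 ?(ltW C0)//.
  by rewrite (le_trans (hPQ x))// mulrCA mulrA.
have := mulr_gt0 C0 (exprn_gt0 2 (U0 x)).
have := exprn_gt0 2 (U0 x).
by rewrite !exprMn sqrrD in h1 h2 *; lra.
Qed.

End DotProduct.

Arguments dot {R n}.
Arguments enorm {R n}.
Arguments orthogonal_mx {R n}.

(** * Metric spaces and their Borel sets *)

Section MetricTopology.
Variable R : realType.

Lemma dball_open (T : Type) (d : T -> T -> R) (x : T) (r : R) :
  is_metric d -> dopen d (dball d x r).
Proof.
move=> [_ _ _ tri] y /= xy; exists (r - d x y); first by rewrite subr_gt0.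
by move=> z; rewrite /dball /= in xy * => yz; have := tri x y z; lra.
Qed.

Lemma dopen_bigcup (T I : Type) (d : T -> T -> R) (P : set I) (F : I -> set T) :
  (forall i, P i -> dopen d (F i)) -> dopen d (\bigcup_(i in P) F i).
Proof.
move=> oF x [i Pi Fix]; have [r r0 rF] := oF i Pi x Fix.
by exists r => // y /rF Fiy; exists i.
Qed.

Lemma finite_nat_bounded (J : set nat) :
  finite_set J -> exists N, forall i, J i -> (i <= N)%N.
Proof.
move=> /finite_seqP[s ->]; exists (\max_(i <- s) i)%N => i /= is_.
exact: leq_bigmax_seq.
Qed.

Lemma dcompact_compl_open (T : Type) (d : T -> T -> R) (A : set T) :
  is_metric d -> dcompact d A -> dopen d (~` A).
Proof.
move=> dm cA x nAx; have [d0 dE dC tri] := dm.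
pose F (i : nat) := [set y | i.+1%:R^-1 < d x y].
have oF i : dopen d (F i).
  move=> y /= xy; exists (d x y - i.+1%:R^-1); first by rewrite subr_gt0.
  move=> z; rewrite /dball /F /= in xy * => yz; have := tri x z y; rewrite (dC z y).
  by move: (i.+1%:R^-1) xy yz => e; lra.
have [|J [/finite_nat_bounded[N JN] AJ]] := cA _ F oF.
  move=> y Ay; have xy : 0 < d x y.
    by rewrite lt0r d0 andbT; apply/eqP => /dE xy; apply: nAx; rewrite xy.
  exists (Num.truncn (d x y)^-1) => //; rewrite /F /=.
  by rewrite -ltf_pV2 ?posrE ?invr_gt0// ?ltr0Sn// invrK truncnS_gt.
exists N.+1%:R^-1; first by rewrite invr_gt0 ltr0Sn.
move=> y /= xy /AJ [i /JN iN]; rewrite /F /= => h.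
have : N.+1%:R^-1 <= i.+1%:R^-1 :> R.
  by rewrite lef_pV2 ?posrE ?ltr0Sn// ler_nat.
move: xy h; rewrite /dball /=.
by move: (N.+1%:R^-1) (i.+1%:R^-1) (d x y) => e e' t; lra.
Qed.

Lemma dcompact_setD (T : Type) (d : T -> T -> R) (A U : set T) :
  dcompact d A -> dopen d U -> dcompact d (A `\` U).
Proof.
move=> cA oU I F oF AUF.
pose G (i : option I) := if i is Some j then F j else U.
have oG i : dopen d (G i) by case: i.
have [|J [fJ AJ]] := cA _ G oG.
  move=> x Ax; have [Ux|nUx] := pselect (U x); first by exists None.
  by have [i _ Fix] := AUF x (conj Ax nUx); exists (Some i).
exists (Some @^-1` J); split.
  by apply: finite_preimage => // i j _ _ [].
by move=> x [Ax nUx]; have [[i|] Ji Gx] := AJ x Ax; [exists i|].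
Qed.

Definition isometric_on (S T : Type) (dS : S -> S -> R) (dT : T -> T -> R)
    (A : set S) (f : S -> T) :=
  forall x y, A x -> A y -> dT (f x) (f y) = dS x y.

(** As [f] is controlled on [A] alone, only the trace on [A] of the preimage is open. [W] is the
    union of the balls about points of [A] whose counterparts of equal radius about the image points
    lie in [V]. *)
Lemma isometric_on_preimage (S T : Type) (dS : S -> S -> R) (dT : T -> T -> R)
    (A : set S) (f : S -> T) (V : set T) :
  is_metric dS -> is_metric dT -> isometric_on _ _ dS dT A f -> dopen dT V ->
  exists2 W, dopen dS W & A `&` f @^-1` V = A `&` W.
Proof.
move=> mS mT iso oV.
pose P := [set xr : S * R | A xr.1 /\ dball dT (f xr.1) xr.2 `<=` V].
exists (\bigcup_(xr in P) dball dS xr.1 xr.2).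
  by apply: dopen_bigcup => -[x r] _; exact: dball_open.
apply/seteqP; split => x [Ax].
  move=> Vfx; split => //; have [r r0 rV] := oV _ Vfx.
  by exists (x, r) => //=; rewrite /dball /=; case: mS => _ /(_ x x)[_ ->].
by move=> [[y r] [/= Ay yr] xy]; split => //; apply: yr; rewrite /dball /= iso.
Qed.

Lemma dcompact_isometric_image (S T : Type) (dS : S -> S -> R)
    (dT : T -> T -> R) (A : set S) (f : S -> T) :
  is_metric dS -> is_metric dT -> isometric_on _ _ dS dT A f ->
  dcompact dS A -> dcompact dT (f @` A).
Proof.
move=> mS mT iso cA I F oF fAF.
have /choice[W hW] : forall i, exists W,
    dopen dS W /\ A `&` f @^-1` (F i) = A `&` W.
  move=> i.
  have [W oW WE] := isometric_on_preimage _ _ _ _ _ _ _ mS mT iso (oF i).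
  by exists W.
have [|J [fJ AJ]] := cA _ W (fun i => (hW i).1).
  move=> x Ax; have [i _ Fi] := fAF (f x) (imageP _ Ax).
  exists i => //; have [_ h] := hW i.
  have : (A `&` W i) x by rewrite -h; split.
  by case.
exists J; split => // _ [x Ax <-]; have [i Ji Wx] := AJ x Ax.
exists i => //; have [_ h] := hW i.
have : (A `&` W i) x by split.
by rewrite -h => -[].
Qed.

Lemma dcompact_setU (T : Type) (d : T -> T -> R) (A B : set T) :
  dcompact d A -> dcompact d B -> dcompact d (A `|` B).
Proof.
move=> cA cB I F oF ABF.
have [|J [fJ AJ]] := cA _ F oF; first by apply: subset_trans ABF => x; left.
have [|K [fK BK]] := cB _ F oF; first by apply: subset_trans ABF => x; right.
exists (J `|` K); split; first by rewrite finite_setU.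
by move=> x [/AJ[i Ji Fx]|/BK[i Ki Fx]]; exists i => //; [left|right].
Qed.

Lemma dcompact_bounded (T : Type) (d : T -> T -> R) (A : set T) :
  is_metric d -> dcompact d A -> exists B, forall x y, A x -> A y -> d x y <= B.
Proof.
move=> dm cA; have [d0 _ dC tri] := dm.
have [A0|/existsNP[x0 _]] := pselect (forall x, ~ A x).
  by exists 0 => x y /A0.
have [|J [/finite_nat_bounded[N JN] AJ]] :=
    cA _ (fun i : nat => dball d x0 i%:R) (fun i => dball_open _ _ _ _ dm).
  move=> x _; exists (Num.truncn (d x0 x)).+1 => //.
  by rewrite /dball /= truncnS_gt.
exists (N%:R + N%:R) => x y /AJ[i /JN iN xi] /AJ[j /JN jN yj].
have iN' : i%:R <= N%:R :> R by rewrite ler_nat.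
have jN' : j%:R <= N%:R :> R by rewrite ler_nat.
rewrite /dball /= in xi yj.
by have := tri x x0 y; rewrite (dC x x0); lra.
Qed.

End MetricTopology.

(** * Measurability of isometric embeddings and of their inverses *)

Section Borel.
Variable R : realType.

Lemma dopen_measurable (T : pointedType) (d : T -> T -> R) (A : set T) :
  dopen d A -> measurable (A : set (borel_of d)).
Proof. exact: sub_sigma_algebra. Qed.

Lemma dcompact_measurable (T : pointedType) (d : T -> T -> R) (A : set T) :
  is_metric d -> dcompact d A -> measurable (A : set (borel_of d)).
Proof.
move=> dm cA; rewrite -[A]setCK; apply: measurableC.
by apply: dopen_measurable; exact: dcompact_compl_open.
Qed.

Lemma measurable_preimage d1 d2 (S1 : measurableType d1) (S2 : measurableType d2)
    (f : S1 -> S2) (B : set S2) :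
  measurable_fun setT f -> measurable B -> measurable (f @^-1` B).
Proof. by move=> mf mB; rewrite -[_ @^-1` _]setTI; exact: mf. Qed.

Lemma measurable_const_set d (S : measurableType d) (P : Prop) :
  measurable [set _ : S | P].
Proof.
have [p|np] := pselect P.
  by rewrite (_ : [set _ | _] = setT)//; apply/seteqP; split.
by rewrite (_ : [set _ | _] = set0)//; apply/seteqP; split.
Qed.

Lemma measurable_borel_of d (S : measurableType d) (T : pointedType)
    (dT : T -> T -> R) (f : S -> borel_of dT) :
  (forall V, dopen dT V -> measurable (f @^-1` V)) -> measurable_fun setT f.
Proof.
move=> h; apply: (@measurability _ _ S (borel_of dT) setT f (dopen dT) erefl).
move=> _ [V oV <-].
by rewrite setTI; exact: h.
Qed.

Section Embedding.
Variables (S T : pointedType) (dS : S -> S -> R) (dT : T -> T -> R).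
Variables (A : set S) (f : S -> T).
Hypotheses (mS : is_metric dS) (mT : is_metric dT).
Hypotheses (cA : dcompact dS A) (iso : isometric_on _ _ _ dS dT A f).

(* The values of [f] outside A are arbitrary, so [f] itself may fail to be
   measurable. *)
Definition embed (x : borel_of dS) : borel_of dT :=
  if `[< A x >] then f x else point.

Definition unembed (z : borel_of dT) : borel_of dS :=
  xget point [set x | A x /\ f x = z].

Lemma embedE x : A x -> embed x = f x.
Proof. by move=> Ax; rewrite /embed asboolT. Qed.

Lemma embedK x : A x -> unembed (f x) = x.
Proof.
move=> Ax; rewrite /unembed; case: xgetP => [y -> [Ay fyx]|/(_ x)[]//].
have [_ dSE _ _] := mS; have [_ dTE _ _] := mT.
by apply/dSE; rewrite -iso// fyx; apply/dTE.
Qed.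

Lemma unembedP z : (f @` A) z -> A (unembed z) /\ f (unembed z) = z.
Proof. by move=> [x Ax <-]; rewrite embedK. Qed.

Lemma measurable_image : measurable (f @` A : set (borel_of dT)).
Proof.
by apply: dcompact_measurable => //; exact: dcompact_isometric_image mS mT iso cA.
Qed.

Lemma measurable_embed : measurable_fun setT embed.
Proof.
apply: measurable_borel_of => V oV.
have mA : measurable (A : set (borel_of dS)) by exact: dcompact_measurable.
have [W oW WE] := isometric_on_preimage _ _ _ _ _ _ _ _ mS mT iso oV.
(* Off [A] the map is constantly [point], so the complement of [A] is taken entirely or not at
   all. *)
have -> : embed @^-1` V = (A `&` W) `|` (~` A `&` [set _ | V point]).
  rewrite -WE; apply/seteqP; split => x; rewrite /embed /=.
    by case: asboolP => Ax Vx; [left|right].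
  by case=> -[Ax Vx]; case: asboolP.
apply: measurableU; apply: measurableI => //.
- exact: dopen_measurable.
- exact: measurableC.
- exact: measurable_const_set.
Qed.

(** Inside the image, the preimage of an open [V] is what remains after removing [f (A \ V)]. That
    set is an isometric image of a compact set, hence compact and Borel. *)
Lemma measurable_unembed : measurable_fun setT unembed.
Proof.
apply: measurable_borel_of => V oV.
have mV : measurable (f @` (A `\` V) : set (borel_of dT)).
  apply: dcompact_measurable => //; apply: (dcompact_isometric_image _ _ _ _ _ _ _ mS mT).
  - by move=> x y [Ax _] [Ay _]; exact: iso.
  - exact: dcompact_setD.
have -> : unembed @^-1` V = (f @` A `\` f @` (A `\` V)) `|`
    (~` (f @` A) `&` [set _ | V point]).
  apply/seteqP; split => z /=.
    move=> Vz; have [fAz|nfAz] := pselect ((f @` A) z).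
      left; split=> // -[x [Ax nVx]] fxz.
      by apply: nVx; rewrite -(embedK x)// fxz.
    right; split => //; move: Vz; rewrite /unembed; case: xgetP => // x _ [Ax fx].
    by exfalso; apply: nfAz; exists x.
  case=> [[fAz h]|[nfAz Vp]].
    have [Ax fx] := unembedP _ fAz.
    by apply: contrapT => nV; apply: h; exists (unembed z).
  rewrite /unembed; case: xgetP => // x _ [Ax fx].
  by exfalso; apply: nfAz; exists x.
apply: measurableU.
  by apply: measurableD => //; exact: measurable_image.
apply: measurableI; first by apply: measurableC; exact: measurable_image.
exact: measurable_const_set.
Qed.

End Embedding.
End Borel.

(** * The Euclidean distance: measurability and diameter *)

Section Euclidean.
Variable R : realType.

Lemma edistE n (x y : vec R n) : edist x y = enorm ((x : 'rV[R]_n) - y).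
Proof.
rewrite /edist /enorm dotE; congr Num.sqrt.
by apply: eq_bigr => i _; rewrite !mxE expr2.
Qed.

Lemma edist_metric n : is_metric (@edist R n).
Proof.
split=> [x y|x y|x y|x y z]; rewrite ?edistE.
- exact: enorm_ge0.
- split=> [/enorm_eq0/eqP|->]; first by rewrite subr_eq0 => /eqP.
  by rewrite subrr /enorm /dot mul0mx mxE sqrtr0.
- by rewrite -enormN opprB.
- by rewrite -[X in enorm X](subrKA (y : 'rV[R]_n)) enormD.
Qed.

Lemma coord_le_edist n (x y : vec R n) i : `|x ord0 i - y ord0 i| <= edist x y.
Proof.
rewrite /edist -sqrtr_sqr ler_wsqrtr// (bigD1 i)//= lerDl.
by apply: sumr_ge0 => j _; exact: sqr_ge0.
Qed.

Lemma measurable_coord n i : measurable_fun setT (fun x : Rn R n => (x : vec R n) ord0 i).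
Proof.
apply: (measurability _ (RGenOInfty.measurableE R)) => _ [_ [a ->] <-].
rewrite setTI; apply: dopen_measurable => x /=; rewrite in_itv /= andbT => ax.
exists (x ord0 i - a); first by rewrite subr_gt0.
move=> y; rewrite /dball /= in_itv /= andbT => xy.
have := le_lt_trans (coord_le_edist _ x y i) xy.
by rewrite ltr_norml => /andP[_]; lra.
Qed.

(** Going through coordinates avoids any Borel structure on the product of two copies of R^n. *)
Lemma measurable_edist d (S : measurableType d) n (u v : S -> Rn R n) :
  measurable_fun setT u -> measurable_fun setT v ->
  measurable_fun setT (fun s => edist (u s) (v s)).
Proof.
move=> mu mv.
have -> : (fun s => edist (u s) (v s)) =
    (fun x : R => x `^ 2^-1) \o (fun s => \sum_(i < n)
      ((u s : vec R n) ord0 i - (v s : vec R n) ord0 i) ^+ 2).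
  apply/funext => s /=; rewrite powR12_sqrt//.
  by apply: sumr_ge0 => i _; exact: sqr_ge0.
apply: measurableT_comp; first exact: measurable_powR.
apply: measurable_sum => i; apply: measurable_funX.
by apply: measurable_funB; [exact: (measurableT_comp (measurable_coord n i) mu)
                           |exact: (measurableT_comp (measurable_coord n i) mv)].
Qed.

Lemma measurable_eisometry n (T : vec R n -> vec R n) :
  eisometry T -> measurable_fun setT (T : Rn R n -> Rn R n).
Proof.
move=> hT; apply: measurable_borel_of => V oV; apply: dopen_measurable => x Vx.
have [r r0 rV] := oV _ Vx; exists r => // y xy; apply: rV.
by rewrite /dball /= hT.
Qed.

Lemma edist_le_diam n (X : set (vec R n)) x y :
  dcompact (@edist R n) X -> X x -> X y -> edist x y <= diam X.
Proof.
move=> cX Xx Xy; have [B XB] := dcompact_bounded _ _ _ _ (edist_metric n) cX.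
apply: sup_upper_bound; last by exists x, y.
split; first by exists (edist x y), x, y.
by exists B => _ [a [b [Xa Xb ->]]]; exact: XB.
Qed.

End Euclidean.

(** * Isometric approximation *)

Lemma polarization_sub (R : realType) n (a b : 'rV[R]_n) :
  2 * dot a b = enorm a ^+ 2 + enorm b ^+ 2 - enorm (a - b) ^+ 2.
Proof. by rewrite !enorm_sqr !dot_linear (dotC _ _ b a); ring. Qed.

Lemma diff_sqr_le (R : realType) (a b e M : R) : 0 <= a <= M -> 0 <= b <= M ->
  `|a - b| <= e -> `|a ^+ 2 - b ^+ 2| <= 2 * M * e.
Proof.
move=> /andP[a0 aM] /andP[b0 bM] abe; rewrite subr_sqr normrM mulrC.
by apply: ler_pM => //; rewrite ger0_norm; lra.
Qed.

(** [F] and [G] are Gram entries expressed by polarization through the squared sides of two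
    triangles with a vertex at the centre; [s], [t] are the displacements of the two points and [z]
    that of the centre. *)
Lemma gram_diff_le (R : realType) (F G a b c a' b' c' M s t z e : R) :
  0 <= M -> 0 <= e -> z <= e ->
  `|a - a'| <= 2 * M * (s + z) -> `|b - b'| <= 2 * M * (t + z) ->
  `|c - c'| <= 2 * M * (s + t) ->
  2 * F = a + b - c -> 2 * G = a' + b' - c' ->
  `|F - G| <= 2 * M * (s + t + 2 * e).
Proof.
move=> M0 e0 ze ha hb hc hF hG.
have Mz : 0 <= M * (e - z) by rewrite mulr_ge0 ?subr_ge0.
have Me : 0 <= M * e by rewrite mulr_ge0.
move: ha hb hc; rewrite !ler_norml => /andP[? ?] /andP[? ?] /andP[? ?] *.
apply/andP; split; lra.
Qed.

Lemma near_isometry (R : realType) n : exists2 C : R, 0 < C &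
  forall (T : Type) (u v : T -> vec R n) (D : T -> R) (M e : R) (t0 : T),
    0 < M -> 0 < e -> (forall t, 0 <= D t) -> D t0 <= e ->
    (forall s t, edist (u s) (u t) <= M) ->
    (forall s t, edist (v s) (v t) <= M) ->
    (forall s t, `|edist (u s) (u t) - edist (v s) (v t)| <= D s + D t) ->
  exists2 f : vec R n -> vec R n, eisometry f &
    forall t, edist (f (u t)) (v t) <= C * Num.sqrt (2 * M / e) * (D t + 2 * e).
Proof.
have [C C0 rigid] := gram_rigidity R n.
exists C => // T u v D M e t0 M0 e0 D0 Dt0 uM vM uvD.
set a := Num.sqrt (2 * M / e).
have a0 : 0 < a by rewrite sqrtr_gt0 !mulr_gt0// invr_gt0.
have a2 : a ^+ 2 * e = 2 * M.
  by rewrite sqr_sqrtr ?divfK ?gt_eqF// ltW// !mulr_gt0// invr_gt0.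
pose f t : 'rV[R]_n := (u t : 'rV[R]_n) - u t0.
pose g t : 'rV[R]_n := (v t : 'rV[R]_n) - v t0.
(* As [a^2 e = 2M], the product [U s * U t] dominates the Gram error [2M (D s + D t + 2e)]. The
   summand [2e] also keeps [U] positive where [D] vanishes. *)
pose U t := a * (D t + 2 * e).
have U0 t : 0 < U t by rewrite mulr_gt0// ltr_wpDl// mulr_gt0.
have fE t : enorm (f t) = edist (u t) (u t0) by rewrite edistE.
have gE t : enorm (g t) = edist (v t) (v t0) by rewrite edistE.
have fB s t : enorm (f s - f t) = edist (u s) (u t).
  by rewrite edistE /f opprB addrA subrK.
have gB s t : enorm (g s - g t) = edist (v s) (v t).
  by rewrite edistE /g opprB addrA subrK.
have sq s t : `|edist (u s) (u t) ^+ 2 - edist (v s) (v t) ^+ 2| <=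
    2 * M * (D s + D t).
  by apply: diff_sqr_le; rewrite ?uM ?vM ?sqrtr_ge0.
(* Since [U >= 2 a e], the bound [|f| <= M] gives [|f| <= M / (2 a e) * U]. *)
have [s||P [Q [oP oQ PQ]]] := rigid T f g U (M / (2 * a * e)) U0.
- have ae : 0 < 2 * a * e by rewrite !mulr_gt0.
  rewrite fE (le_trans (uM _ _))// /U -mulrA ler_peMr//; first exact: ltW.
  rewrite mulrC ler_pdivlMr// mul1r.
  by have := mulr_ge0 (ltW a0) (D0 s); lra.
- move=> s t; have h1 := sq s t0; have h2 := sq t t0; have h3 := sq s t.
  have := polarization_sub R n (f s) (f t); have := polarization_sub R n (g s) (g t).
  rewrite !fE !gE fB gB => pg pf.
  have UU : U s * U t * e = 2 * M * ((D s + 2 * e) * (D t + 2 * e)).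
    by rewrite /U -a2; ring.
  have h : `|dot (f s) (f t) - dot (g s) (g t)| <= 2 * M * (D s + D t + 2 * e).
    exact: (@gram_diff_le R _ _ _ _ _ _ _ _ _ _ _ _ _ (ltW M0) (ltW e0) Dt0
      h1 h2 h3 pf pg).
  rewrite (le_trans h)// -(ler_pM2r e0) UU -(mulrA (2 * M)) ler_pM2l ?mulr_gt0//.
  have := mulr_ge0 (D0 s) (D0 t); have := mulr_ge0 (D0 s) (ltW e0).
  by have := mulr_ge0 (D0 t) (ltW e0); have := mulr_gt0 e0 e0; lra.
have oPQ : orthogonal_mx (P *m Q^T).
  by apply: orthogonal_mxM => //; exact: orthogonal_mxT.
(* Move the centre [u t0] to the origin, rotate by [P] and back by the inverse of [Q], then move the
   origin to [v t0]. *)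
exists (fun x => ((x : 'rV[R]_n) - u t0) *m (P *m Q^T) + v t0).
  move=> x y; rewrite !edistE opprD addrACA subrr addr0 -mulmxBl.
  by rewrite orthogonal_enorm// opprB addrA subrK.
move=> t; rewrite edistE -addrA -(opprB (v t : 'rV[R]_n)) -/(f t) -/(g t).
rewrite -(orthogonal_enorm _ _ _ _ oQ) mulmxBl.
rewrite -mulmxA -(mulmxA P) (mulmx1C oQ) mulmx1 -mulrA.
exact: PQ.
Qed.

(** * Integration against probability measures *)

Section FullMeasure.
Context d (T : measurableType d) (R : realType) (P : probability T R).

Lemma probability_full_setC (A : set T) :
  measurable A -> P A = 1%E -> P (~` A) = 0%E.
Proof. by move=> mA PA; rewrite probability_setC// PA subee. Qed.

Lemma probability_full_setI (A B : set T) : measurable A -> measurable B ->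
  P A = 1%E -> P (A `&` B) = P B.
Proof.
move=> mA mB PA.
have BA : P (B `\` A) = 0%E.
  apply/eqP; rewrite eq_le measure_ge0 andbT -(probability_full_setC A mA PA).
  apply: le_measure; rewrite ?inE; [exact: measurableD|exact: measurableC|].
  by move=> x [].
by rewrite [RHS](measureDI P mB mA) setIC [X in (X + _)%E]BA add0e.
Qed.

Lemma ge0_integral_full (A : set T) (f : T -> \bar R) :
  measurable A -> P A = 1%E -> measurable_fun setT f -> (forall x, 0 <= f x)%E ->
  (\int[P]_x f x = \int[P]_(x in A) f x)%E.
Proof.
move=> mA PA mf f0.
rewrite (@ge0_negligible_integral _ _ _ _ _ (~` A))//.
- by rewrite setTD setCK.
- exact: measurableC.
- exact: probability_full_setC.
Qed.

(* On nonnegative functions [integral] is a lower integral, hence monotone even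
   when they are not measurable. *)
Lemma ge0_le_lower_integral (A : set T) (f g : T -> \bar R) :
  (forall x, 0 <= f x)%E -> (forall x, 0 <= g x)%E ->
  (forall x, A x -> f x <= g x)%E ->
  (\int[P]_(x in A) f x <= \int[P]_x g x)%E.
Proof.
move=> f0 g0 fg; rewrite integral_mkcond !ge0_integralTE//; last first.
  by move=> x; rewrite patchE; case: ifP.
apply: le_ereal_sup => _ [h hf <-]; exists h => // x.
rewrite (le_trans (hf x))// patchE; case: ifPn => // /set_mem; exact: fg.
Qed.

(** Chebyshev's argument: were [D > e] on all of [A], the integral would be at least [e^p]. The
    point found serves as the centre of the two configurations. *)
Lemma lower_integral_small_value (A : set T) (D : T -> R) (p e : R) :
  0 < p -> 0 < e -> measurable A -> P A = 1%E ->
  (\int[P]_x (D x `^ p)%:E < (e `^ p)%:E)%E ->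
  exists2 x, A x & D x <= e.
Proof.
move=> p0 e0 mA PA; apply: contraPP => h; apply/negP; rewrite -leNgt.
rewrite -[leLHS]mule1 -PA -integral_cst//; apply: ge0_le_lower_integral.
- by move=> x; rewrite lee_fin powR_ge0.
- by move=> x; rewrite lee_fin powR_ge0.
- move=> x Ax; rewrite lee_fin ge0_ler_powR ?nnegrE ?(ltW p0) ?(ltW e0)//.
    by rewrite leNgt; apply/negP => Dx; apply: h; exists x => //; apply: ltW;
      rewrite (lt_trans Dx).
  by rewrite leNgt; apply/negP => Dx; apply: h; exists x => //; exact: ltW.
Qed.

Lemma powRD_le (a b p : R) : 0 <= a -> 0 <= b -> 0 <= p ->
  (a + b) `^ p <= 2 `^ p * (a `^ p + b `^ p).
Proof.
move=> a0 b0 p0; wlog ab : a b a0 b0 / a <= b.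
  move=> h; have [/h->//|/ltW ba] := leP a b.
  by rewrite addrC [X in _ * X]addrC h.
rewrite (@le_trans _ _ ((2 * b) `^ p))//.
  by rewrite ge0_ler_powR ?nnegrE ?addr_ge0 ?mulr_ge0//; lra.
by rewrite powRM// ler_wpM2l ?powR_ge0// lerDr powR_ge0.
Qed.

(** On [A], [F^p <= (2k)^p (D^p + (2e)^p)], which integrates to at most [(2k)^p * 2 * (2e)^p]. As
    [p >= 1], the factor 2 is at most [2^p], so the constant 8 is the same for every [p]. *)
Lemma integral_powR_affine_bound (A : set T) (F D : T -> R) (p e k : R) :
  1 <= p -> 0 < e -> 0 < k -> measurable A -> P A = 1%E ->
  measurable_fun setT F -> (forall x, 0 <= F x) -> (forall x, 0 <= D x) ->
  (forall x, A x -> F x <= k * (D x + 2 * e)) ->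
  (\int[P]_x (D x `^ p)%:E < (e `^ p)%:E)%E ->
  (\int[P]_x (F x `^ p)%:E <= ((8 * k * e) `^ p)%:E)%E.
Proof.
move=> p1 e0 k0 mA PA mF F0 D0 FD De.
have p0 : 0 <= p by lra.
pose l := (2 * k) `^ p; pose c := (2 * e) `^ p.
have l0 : 0 < l by rewrite powR_gt0 ?mulr_gt0.
have c0 : 0 <= c by exact: powR_ge0.
(* [D] may fail to be measurable; [H] is a measurable minorant of [D `^ p]. *)
pose H x := Num.max 0 (F x `^ p / l - c).
have H0 x : 0 <= H x by rewrite le_max lexx.
have mFp : measurable_fun setT (fun x => F x `^ p).
  exact: (measurableT_comp (measurable_powR p) mF).
have mH : measurable_fun setT H.
  apply: measurable_maxr => //; apply: measurable_funB => //.
  exact: measurable_funM.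
have HD x : A x -> H x <= D x `^ p.
  move=> Ax; rewrite ge_max powR_ge0 /= lerBlDr ler_pdivrMr// mulrC.
  rewrite (@le_trans _ _ ((k * (D x + 2 * e)) `^ p))//.
    rewrite ge0_ler_powR ?nnegrE ?FD//.
    by rewrite mulr_ge0 ?addr_ge0 ?mulr_ge0 ?(ltW k0) ?(ltW e0).
  rewrite powRM ?addr_ge0 ?mulr_ge0 ?(ltW k0) ?(ltW e0)//.
  rewrite /l powRM ?(ltW k0)// (mulrC (2 `^ p)) -mulrA ler_wpM2l ?powR_ge0//.
  by apply: powRD_le; rewrite ?mulr_ge0 ?(ltW e0).
rewrite (ge0_integral_full A)//; last 2 first.
  - exact/measurable_EFinP.
  - by move=> x; rewrite lee_fin powR_ge0.
have mS (B : set T) (g : T -> R) : measurable_fun setT g ->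
    measurable_fun B (fun x => (g x)%:E).
  by move=> mg; apply/measurable_EFinP; exact: measurable_funTS.
apply: (@le_trans _ _ (\int[P]_(x in A) (l%:E * ((H x)%:E + c%:E)))%E).
  apply: ge0_le_integral => //.
  - by move=> x _; rewrite lee_fin powR_ge0.
  - exact: (mS A _ mFp).
  - rewrite (_ : (fun x => _) = fun x => (l * (H x + c))%:E)//.
    apply: mS; apply: measurable_funM => //; exact: measurable_funD.
  - move=> x Ax; rewrite -EFinD -EFinM lee_fin mulrC -ler_pdivrMr// -lerBlDr.
    by rewrite le_max lexx orbT.
rewrite ge0_integralZl_EFin//; last 3 first.
  - by move=> x _; rewrite -EFinD lee_fin addr_ge0.
  - by rewrite (_ : (fun x => _) = fun x => (H x + c)%:E)//; apply: mS;
      exact: measurable_funD.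
  - exact: ltW.
rewrite ge0_integralD//; last 2 first.
  - by move=> x _; rewrite lee_fin.
  - exact: (mS A _ mH).
have -> : (\int[P]_(x in A) c%:E = c%:E)%E.
  by rewrite -[RHS]mule1 -PA -integral_cst.
have HI : (\int[P]_(x in A) (H x)%:E <= (e `^ p)%:E)%E.
  apply: le_trans (ltW De); apply: ge0_le_lower_integral => x; rewrite lee_fin//.
  - exact: powR_ge0.
  - exact: HD.
apply: (@le_trans _ _ (l%:E * ((e `^ p)%:E + c%:E))%E).
  by rewrite lee_pmul2l// ?leeD2r.
rewrite -EFinD -EFinM lee_fin.
have -> : 8 * k * e = (2 * k) * (2 * (2 * e)) by ring.
rewrite [leRHS]powRM ?mulr_ge0 ?(ltW k0) ?(ltW e0)// ler_pM2l//.
rewrite powRM ?mulr_ge0 ?(ltW e0)// -/c.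
have ec : e `^ p <= c.
  by rewrite ge0_ler_powR ?nnegrE ?mulr_ge0 ?(ltW e0)//; lra.
have : 2 <= 2 `^ p :> R by rewrite -[X in X <= _]powRr1// ler_powR// ler1n.
move=> /(ler_wpM2r c0); lra.
Qed.

End FullMeasure.

(** * Comparison of the Monge distances *)

Section EmbeddedMeasures.
Variables (R : realType) (n : nat) (X : set (vec R n)) (mu : probability (Rn R n) R).
Hypothesis Xmm : euclid_mm X mu.
Variables (Z : pointedType) (dZ : Z -> Z -> R) (f : vec R n -> Z).
Hypotheses (mZ : is_metric dZ) (iso : isom_embedding X dZ f).

Definition emb : Rn R n -> borel_of dZ := embed R (vec R n) Z (@edist R n) dZ X f.
Definition unemb : borel_of dZ -> Rn R n := unembed R (vec R n) Z (@edist R n) dZ X f.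

Lemma embK x : X x -> unemb (f x) = x.
Proof. by move=> Xx; apply: embedK => //; exact: edist_metric. Qed.

Lemma embE x : X x -> emb x = f x.
Proof. exact: embedE. Qed.

Lemma unembP z : (f @` X) z -> X (unemb z) /\ f (unemb z) = z.
Proof. by move=> [x Xx <-]; rewrite embK. Qed.

Lemma measurable_emb : measurable_fun setT emb.
Proof. by case: Xmm => cX _ _; apply: measurable_embed => //; exact: edist_metric. Qed.

Lemma measurable_unemb : measurable_fun setT unemb.
Proof. by case: Xmm => cX _ _; apply: measurable_unembed => //; exact: edist_metric. Qed.

Lemma measurable_mm : measurable (X : set (Rn R n)).
Proof. by case: Xmm => cX _ _; apply: dcompact_measurable => //; exact: edist_metric. Qed.

Lemma measurable_emb_image : measurable (f @` X : set (borel_of dZ)).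
Proof.
case: Xmm => cX _ _.
by apply: (measurable_image R (vec R n) Z (@edist R n)) => //; exact: edist_metric.
Qed.

(** Identifies the measure that the embedding distance puts on [Z] with the pushforward along the
    measurable [emb]; the two maps differ only off [X], which is a null set. *)
Lemma measure_emb (B : set (borel_of dZ)) : measurable B ->
  mu (X `&` f @^-1` B) = mu (emb @^-1` B).
Proof.
move=> mB; case: (Xmm) => _ muX _.
have mE : measurable (emb @^-1` B).
  by apply: measurable_preimage => //; exact: measurable_emb.
rewrite -(probability_full_setI _ _ _ mu _ _ measurable_mm mE muX).
by congr (mu _); apply/seteqP; split=> x [Xx]; rewrite /= embE.
Qed.

End EmbeddedMeasures.

(** The map on [Z] is conjugated back to [psi] on R^n, while the isometry comes from applying
    [near_isometry] to pairs indexed by a set of full measure in [Z]. Both costs are then compared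
    as integrals over [Z]. *)
Lemma monge_to_isometry (R : realType) n : exists2 C : R, 0 < C &
  forall (X : set (vec R n)) (muX : probability (Rn R n) R)
    (Y : set (vec R n)) (muY : probability (Rn R n) R) (p e : R)
    (Z : pointedType) (dZ : Z -> Z -> R) (fX fY : vec R n -> Z)
    (alpha beta : probability (borel_of dZ) R)
    (phi : borel_of dZ -> borel_of dZ),
  let M := Num.max (diam X) (diam Y) in
  euclid_mm X muX -> euclid_mm Y muY -> 1 <= p -> 0 < e -> 0 < M ->
  is_metric dZ -> isom_embedding X dZ fX -> isom_embedding Y dZ fY ->
  (forall A : set (borel_of dZ), measurable A -> alpha A = muX (X `&` fX @^-1` A)) ->
  (forall A : set (borel_of dZ), measurable A -> beta A = muY (Y `&` fY @^-1` A)) ->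
  measurable_fun setT phi ->
  (forall B : set (borel_of dZ), measurable B -> alpha (phi @^-1` B) = beta B) ->
  (\int[alpha]_z (dZ z (phi z) `^ p)%:E < (e `^ p)%:E)%E ->
  exists2 T : vec R n -> vec R n, eisometry T &
    (monge_cost_iso p T X muX muY <= ((C * Num.sqrt M * Num.sqrt e) `^ p)%:E)%E.
Proof.
have [C C0 near] := near_isometry R n.
(* This is [8 k e] for [k = C sqrt (2 M / e)], with [sqrt M * sqrt e] taken out. *)
exists (8 * C * Num.sqrt 2); first by rewrite !mulr_gt0 ?sqrtr_gt0.
move=> X muX Y muY p e Z dZ fX fY alpha beta phi M Xmm Ymm p1 e0 M0 mZ isoX isoY.
move=> alphaE betaE mphi push cost.
have [dZ0 _ dZC tri] := mZ.
pose eX := emb R n X Z dZ fX; pose hX := unemb R n X Z dZ fX.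
pose hY := unemb R n Y Z dZ fY.
have meX : measurable_fun setT eX by exact: measurable_emb Xmm _ _ _ mZ isoX.
have mhX : measurable_fun setT hX by exact: measurable_unemb Xmm _ _ _ mZ isoX.
have mhY : measurable_fun setT hY by exact: measurable_unemb Ymm _ _ _ mZ isoY.
have alphaE' A : measurable A -> alpha A = muX (eX @^-1` A).
  by move=> mA; rewrite alphaE// (measure_emb _ _ _ _ Xmm _ _ _ mZ isoX).
pose psi : Rn R n -> Rn R n := hY \o phi \o eX.
have mpsi : measurable_fun setT psi.
  by apply: measurableT_comp => //; exact: measurableT_comp.
have pushpsi B : measurable B -> muX (psi @^-1` B) = muY B.
  move=> mB; have mhB := measurable_preimage _ _ _ _ _ _ mhY mB.
  rewrite /psi comp_preimage comp_preimage -alphaE'; last exact: measurable_preimage.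
  rewrite push// betaE//.
  have [_ muY1 _] := Ymm.
  rewrite -(probability_full_setI _ _ _ muY _ _ (measurable_mm _ _ _ _ Ymm) mB muY1).
  by congr (muY _); apply/seteqP; split=> y [Yy] /=; rewrite /hY embK.
(* On [W] both [hX z] and [hY (phi z)] are genuine inverse images; elsewhere at least one is a
   default value. *)
pose W : set (borel_of dZ) := (fX @` X) `&` (phi @^-1` (fY @` Y)).
have mfX : measurable (fX @` X : set (borel_of dZ)).
  exact: measurable_emb_image Xmm _ _ _ mZ isoX.
have mfY : measurable (fY @` Y : set (borel_of dZ)).
  exact: measurable_emb_image Ymm _ _ _ mZ isoY.
have mW : measurable W by apply: measurableI => //; exact: measurable_preimage.
have W1 : alpha W = 1%E.
  rewrite /W probability_full_setI//; [|exact: measurable_preimage|].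
    rewrite push// betaE// setIidl; first by case: Ymm.
    exact: preimage_image.
  rewrite alphaE// setIidl; first by case: Xmm.
  exact: preimage_image.
have [z0 Wz0 Dz0] := lower_integral_small_value _ _ _ alpha W
  (fun z => dZ z (phi z)) p e (lt_le_trans ltr01 p1) e0 mW W1 cost.
pose S := {z | W z}.
pose u (s : S) := hX (sval s); pose v (s : S) := hY (phi (sval s)).
have uP s : X (u s) /\ fX (u s) = sval s.
  by have [hz _] := svalP s; exact: unembP mZ isoX _ hz.
have vP s : Y (v s) /\ fY (v s) = phi (sval s).
  by have [_ hz] := svalP s; exact: unembP mZ isoY _ hz.
have uE s t : edist (u s) (u t) = dZ (sval s) (sval t).
  rewrite -(uP s).2 -(uP t).2 isoX//; first exact: (uP s).1.
  exact: (uP t).1.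
have vE s t : edist (v s) (v t) = dZ (phi (sval s)) (phi (sval t)).
  rewrite -(vP s).2 -(vP t).2 isoY//; first exact: (vP s).1.
  exact: (vP t).1.
have uM s t : edist (u s) (u t) <= M.
  have [cX _ _] := Xmm.
  by rewrite le_max (edist_le_diam _ _ _ _ _ cX (uP s).1 (uP t).1).
have vM s t : edist (v s) (v t) <= M.
  have [cY _ _] := Ymm.
  by rewrite le_max (edist_le_diam _ _ _ _ _ cY (vP s).1 (vP t).1) orbT.
have [|s t|f fiso fuv] := near S u v (fun s => dZ (sval s) (phi (sval s))) M e
    (exist _ z0 Wz0) M0 e0 _ Dz0 uM vM.
- by move=> s; exact: dZ0.
- rewrite uE vE; move: (sval s) (sval t) => {}s {}t.
  have := tri s (phi s) t; have := tri (phi s) (phi t) t.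
  have := tri (phi s) s (phi t); have := tri s t (phi t).
  rewrite (dZC (phi s) s) (dZC (phi t) t) ler_norml => *.
  by apply/andP; split; lra.
exists f => //.
(* The integrand of the cost of [psi] against [f], transported to [Z]; it is measurable because it
   is a distance in R^n. *)
pose F (z : borel_of dZ) : R := edist (f (hX z)) (hY (phi z)).
have mF : measurable_fun setT F.
  apply: measurable_edist; last exact: measurableT_comp.
  by apply: measurableT_comp => //; exact: measurable_eisometry.
set k := C * Num.sqrt (2 * M / e) in fuv.
have k0 : 0 < k.
  by rewrite mulr_gt0// sqrtr_gt0 !mulr_gt0// invr_gt0.
have FI : (\int[alpha]_z (F z `^ p)%:E <= ((8 * k * e) `^ p)%:E)%E.
  apply: (integral_powR_affine_bound _ _ _ alpha W F (fun z => dZ z (phi z))) => //.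
  - by move=> z; exact: sqrtr_ge0.
  - by move=> z Wz; exact: (fuv (exist _ z Wz)).
have ke : 8 * k * e = 8 * C * Num.sqrt 2 * Num.sqrt M * Num.sqrt e.
  rewrite /k sqrtrM ?mulr_ge0 ?(ltW M0)// sqrtrM// sqrtrV ?(ltW e0)//.
  rewrite -[X in _ * X = _](sqr_sqrtr (ltW e0)).
  by field; rewrite gt_eqF// sqrtr_gt0.
rewrite -ke; apply: le_trans FI.
apply: (@le_trans _ _ (\int[muX]_(x in X) (edist (f x) (psi x) `^ p)%:E)%E).
  by apply: ereal_inf_lbound; exists psi.
have mFp : measurable_fun setT (fun z => (F z `^ p)%:E).
  by apply/measurable_EFinP; exact: (measurableT_comp (measurable_powR p) mF).
have Fp0 z : (0 <= (F z `^ p)%:E)%E by rewrite lee_fin powR_ge0.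
rewrite (@eq_integral _ _ _ muX _ ((fun z => (F z `^ p)%:E) \o eX)); last first.
  by move=> x /set_mem Xx /=; rewrite /F /psi /= /eX /hX embE// embK.
have [_ muX1 _] := Xmm.
have mFe : measurable_fun setT ((fun z => (F z `^ p)%:E) \o eX).
  exact: measurableT_comp.
rewrite -(ge0_integral_full _ _ _ muX X)//; last 2 first.
- exact: measurable_mm Xmm.
- by move=> x; exact: Fp0.
have := @ge0_integral_pushforward _ _ _ _ R eX meX muX setT _ measurableT mFp.
rewrite preimage_setT => <-; last by move=> z _.
rewrite [leRHS](eq_measure_integral (pushforward muX eX))//.
by move=> A mA _; exact: alphaE'.
Qed.

(** * Subspaces as metric spaces, and the first inequality for one transport map *)

(** The base point [a] is a parameter of the type so that the subspace can be declared pointed, as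
    [borel_of] requires. *)
Definition pointed_sig (T : Type) (A : set T) (a : {x | A x}) : Type := {x | A x}.
HB.instance Definition _ (T : Type) (A : set T) (a : {x | A x}) :=
  gen_eqMixin (pointed_sig T A a).
HB.instance Definition _ (T : Type) (A : set T) (a : {x | A x}) :=
  gen_choiceMixin (pointed_sig T A a).
HB.instance Definition _ (T : Type) (A : set T) (a : {x | A x}) :=
  isPointed.Build (pointed_sig T A a) a.

Section SubspaceMetric.
Variables (R : realType) (T : Type) (d : T -> T -> R) (A : set T) (a : {x | A x}).
Hypothesis dm : is_metric d.

Definition sub_metric (x y : pointed_sig T A a) : R := d (sval x) (sval y).

Definition sub_inj (x : T) : pointed_sig T A a :=
  if pselect (A x) is left Ax then exist _ x Ax else a.

Lemma sub_injE x : A x -> sval (sub_inj x) = x.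
Proof. by rewrite /sub_inj; case: pselect. Qed.

Lemma sub_metric_metric : is_metric sub_metric.
Proof.
have [d0 dE dC tri] := dm; rewrite /sub_metric.
split=> [x y|x y|x y|x y z]; [exact: d0| |exact: dC|exact: tri].
split=> [/dE|->]; last exact/dE.
by move: x y => [x hx] [y hy] /= xy; exact: eq_exist.
Qed.

Lemma sub_metric_compact : dcompact d A -> dcompact sub_metric setT.
Proof.
move=> cA; have -> : [set: pointed_sig T A a] = sub_inj @` A.
  apply/seteqP; split => // -[x Ax] _; exists x => //.
  rewrite /sub_inj; case: pselect => // Ax'; exact: eq_exist.
apply: (dcompact_isometric_image _ _ _ d) cA => //; first exact: sub_metric_metric.
by move=> x y Ax Ay; rewrite /sub_metric !sub_injE.
Qed.

End SubspaceMetric.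

Lemma measurable_sub_val (R : realType) n (A : set (vec R n)) (a : {x | A x}) :
  measurable_fun setT (fun z : borel_of (sub_metric R _ (@edist R n) A a) =>
    sval z : Rn R n).
Proof.
apply: measurable_borel_of => V oV; apply: dopen_measurable => x Vx.
by have [r r0 rV] := oV _ Vx; exists r => // y xy; apply: rV.
Qed.

Lemma euclid_mm_nonempty (R : realType) n (X : set (vec R n)) mu :
  euclid_mm X mu -> X !=set0.
Proof.
move=> [_ muX _]; apply/set0P/eqP => X0; move: muX.
by rewrite X0 measure0 => /eqP; rewrite eq_sym onee_eq0.
Qed.

(** The isometry is absorbed into the embedding of [X], so that moving [T x] to [phi x] inside the
    union costs exactly the integrand on the right. *)
Lemma dGM_emb_le_monge (R : realType) n (X : set (vec R n)) muX
    (Y : set (vec R n)) muY (p : R) (T : vec R n -> vec R n) (phi : Rn R n -> Rn R n) :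
  euclid_mm X muX -> euclid_mm Y muY -> 1 <= p -> eisometry T ->
  measurable_fun setT phi ->
  (forall B : set (Rn R n), measurable B -> muX (phi @^-1` B) = muY B) ->
  (dGM_emb p X muX Y muY <=
   (\int[muX]_(x in X) (edist (T x) (phi x) `^ p)%:E) `^ p^-1)%E.
Proof.
move=> Xmm Ymm p1 iT mphi push.
have [cX muX1 _] := Xmm; have [cY muY1 _] := Ymm.
pose A := T @` X `|` Y.
have [y0 Yy0] := euclid_mm_nonempty _ _ _ _ Ymm.
pose a : {x | A x} := exist _ y0 (or_intror Yy0).
pose dZ := sub_metric R _ (@edist R n) A a.
have mZ : is_metric dZ by apply: sub_metric_metric; exact: edist_metric.
have cZ : dcompact dZ setT.
  apply: sub_metric_compact; first exact: edist_metric.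
  apply: dcompact_setU => //.
  apply: (dcompact_isometric_image _ _ _ (@edist R n)) cX; try exact: edist_metric.
  by move=> x y _ _; exact: iT.
pose fX x := sub_inj _ A a (T x); pose fY y := sub_inj _ A a y.
have fXE x : X x -> sval (fX x) = T x by move=> Xx; apply: sub_injE; left; exists x.
have fYE y : Y y -> sval (fY y) = y by move=> Yy; apply: sub_injE; right.
have isoX : isom_embedding X dZ fX.
  by move=> x y Xx Xy; rewrite /dZ /sub_metric !fXE.
have isoY : isom_embedding Y dZ fY.
  by move=> x y Xx Xy; rewrite /dZ /sub_metric !fYE.
pose eX := emb R n X _ dZ fX; pose hX := unemb R n X _ dZ fX.
pose eY := emb R n Y _ dZ fY.
have meX : measurable_fun setT eX by exact: measurable_emb Xmm _ _ _ mZ isoX.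
have meY : measurable_fun setT eY by exact: measurable_emb Ymm _ _ _ mZ isoY.
have mhX : measurable_fun setT hX by exact: measurable_unemb Xmm _ _ _ mZ isoX.
have mX := measurable_mm _ _ _ _ Xmm; have mY := measurable_mm _ _ _ _ Ymm.
pose EX : {mfun Rn R n >-> borel_of dZ} := HB.pack eX (isMeasurableFun.Build _ _ _ _ _ meX).
pose EY : {mfun Rn R n >-> borel_of dZ} := HB.pack eY (isMeasurableFun.Build _ _ _ _ _ meY).
pose alpha : probability (borel_of dZ) R := distribution muX EX.
pose beta : probability (borel_of dZ) R := distribution muY EY.
pose phiZ : borel_of dZ -> borel_of dZ := eY \o phi \o hX.
have mphiZ : measurable_fun setT phiZ.
  by apply: measurableT_comp => //; exact: measurableT_comp.
apply: (@le_trans _ _ (dMonge p alpha beta)).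
  apply: ereal_inf_lbound; exists _, dZ, fX, fY, alpha, beta; split => //.
  - by move=> B mB; rewrite (measure_emb _ _ _ _ Xmm _ _ _ mZ isoX).
  - by move=> B mB; rewrite (measure_emb _ _ _ _ Ymm _ _ _ mZ isoY).
have pushZ (B : set (borel_of dZ)) : measurable B -> alpha (phiZ @^-1` B) = beta B.
  move=> mB; rewrite /alpha /beta /distribution /pushforward /=.
  have mB' := measurable_preimage _ _ _ _ _ _ meY mB.
  transitivity (muX (phi @^-1` (eY @^-1` B))); last exact: push.
  have m1 := measurable_preimage _ _ _ _ _ _ mphi mB'.
  have m2 := measurable_preimage _ _ _ _ _ _ meX
    (measurable_preimage _ _ _ _ _ _ mphiZ mB).
  rewrite -(probability_full_setI _ _ _ muX _ _ mX m1 muX1).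
  transitivity (muX (X `&` eX @^-1` (phiZ @^-1` B))).
    by rewrite (probability_full_setI _ _ _ muX _ _ mX m2 muX1).
  congr (muX _); apply/seteqP; split=> x [Xx];
    by rewrite /= /phiZ /= /eX /hX embE// (embK _ _ _ _ _ _ mZ isoX).
apply: (@le_trans _ _ ((\int[alpha]_z (dZ z (phiZ z) `^ p)%:E) `^ p^-1)%E).
  by apply: ereal_inf_lbound; exists phiZ.
have mI (u v : borel_of dZ -> Rn R n) : measurable_fun setT u ->
    measurable_fun setT v ->
    measurable_fun setT (fun z => (edist (u z) (v z) `^ p)%:E).
  move=> mu mv; apply/measurable_EFinP.
  by apply: (measurableT_comp (measurable_powR p)); exact: measurable_edist.
have msv := measurable_sub_val R n A a.
have mG : measurable_fun setT (fun z : borel_of dZ => (dZ z (phiZ z) `^ p)%:E).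
  by apply: mI => //; exact: measurableT_comp msv mphiZ.
have mH : measurable_fun setT (fun x : Rn R n => (edist (T x) (phi x) `^ p)%:E).
  apply/measurable_EFinP; apply: (measurableT_comp (measurable_powR p)).
  by apply: measurable_edist => //; exact: measurable_eisometry.
apply: gt0_ler_poweR.
- by rewrite invr_ge0; lra.
- by rewrite in_itv /= leey andbT; apply: integral_ge0 => z _; rewrite lee_fin powR_ge0.
- by rewrite in_itv /= leey andbT; apply: integral_ge0 => z _; rewrite lee_fin powR_ge0.
rewrite (@ge0_integral_pushforward _ _ _ _ R eX meX muX setT _ measurableT mG); last first.
  by move=> z _; rewrite lee_fin powR_ge0.
rewrite preimage_setT.
(* On a null set [phi] may leave [Y], where [eY] takes a default value; the integrands are compared
   only where it stays in [Y]. *)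
have mXY : measurable (X `&` phi @^-1` Y : set (Rn R n)).
  by apply: measurableI => //; exact: measurable_preimage.
have muXY : muX (X `&` phi @^-1` Y) = 1%E.
  by rewrite probability_full_setI// ?push//; exact: measurable_preimage.
rewrite (ge0_integral_full _ _ _ muX _ _ mXY muXY); last 2 first.
- exact: measurableT_comp mG meX.
- by move=> x; rewrite lee_fin powR_ge0.
rewrite (@eq_integral _ _ _ muX _ (fun x => (edist (T x) (phi x) `^ p)%:E)); last first.
  move=> x /set_mem [Xx Yx] /=; rewrite /phiZ /= /eX /hX embE//.
  by rewrite (embK _ _ _ _ _ _ mZ isoX)// /eY embE// /dZ /sub_metric fXE// fYE.
apply: ge0_subset_integral => //.
- exact: measurable_funTS.
- by move=> x _; rewrite lee_fin powR_ge0.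
Qed.

(** * Powers, infima and the two inequalities *)

Lemma poweRK (R : realType) (x : \bar R) (p : R) :
  (0 <= x)%E -> 0 < p -> ((x `^ p) `^ p^-1)%E = x.
Proof. by move=> x0 p0; rewrite -poweRrM mulfV ?gt_eqF// poweRe1. Qed.

Lemma poweRVK (R : realType) (x : \bar R) (p : R) :
  (0 <= x)%E -> 0 < p -> ((x `^ p^-1) `^ p)%E = x.
Proof. by move=> x0 p0; rewrite -poweRrM mulVf ?gt_eqF// poweRe1. Qed.

Lemma le_poweR (R : realType) (x y : \bar R) (p : R) :
  0 <= p -> (0 <= x)%E -> (x <= y)%E -> (x `^ p <= y `^ p)%E.
Proof.
move=> p0 x0 xy; apply: gt0_ler_poweR => //; rewrite in_itv /= leey andbT//.
exact: le_trans xy.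
Qed.

Lemma dGM_emb_ge0 (R : realType) n (X : set (vec R n)) muX
    (Y : set (vec R n)) muY (p : R) : (0 <= dGM_emb p X muX Y muY)%E.
Proof.
apply: le_ereal_inf_tmp => _ [Z [dZ [fX [fY [al [be [_ _ _ _ ->]]]]]]].
by apply: le_ereal_inf_tmp => _ [phi [_ _ ->]]; exact: poweR_ge0.
Qed.

(** In [dM_iso] the root stands outside the infimum over transport maps, in [dMonge] inside it.
    Raising to the power [p] reduces the claim to single maps without commuting the two. *)
Lemma dGM_emb_le_dM_iso (R : realType) n (X : set (vec R n)) muX
    (Y : set (vec R n)) muY (p : R) :
  euclid_mm X muX -> euclid_mm Y muY -> 1 <= p ->
  (dGM_emb p X muX Y muY <= dM_iso p X muX Y muY)%E.
Proof.
move=> Xmm Ymm p1; have p0 : 0 < p by lra.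
have d0 := dGM_emb_ge0 R n X muX Y muY p.
apply: le_ereal_inf_tmp => _ [T [iT ->]].
rewrite -[leLHS](poweRK _ _ _ d0 p0).
apply: le_poweR; [by rewrite invr_ge0 ltW|exact: poweR_ge0|].
apply: le_ereal_inf_tmp => _ [phi [mphi push ->]].
have I0 : (0 <= \int[muX]_(x in X) (edist (T x) (phi x) `^ p)%:E)%E.
  by apply: integral_ge0 => x _; rewrite lee_fin powR_ge0.
rewrite -[leRHS](poweRVK _ _ _ I0 p0).
by apply: le_poweR => //; [exact: ltW|exact: dGM_emb_le_monge].
Qed.

(** Both spaces are single points, so the translation from [x0] to [y0] together with the constant
    map [y0] has cost zero. *)
Lemma dM_iso_singletons (R : realType) n (X : set (vec R n)) muX
    (Y : set (vec R n)) muY (p : R) :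
  euclid_mm X muX -> euclid_mm Y muY -> 1 <= p ->
  Num.max (diam X) (diam Y) <= 0 -> (dM_iso p X muX Y muY <= 0)%E.
Proof.
move=> Xmm Ymm p1; rewrite ge_max => /andP[X0 Y0].
have p0 : 0 < p by lra.
have [cX muX1 _] := Xmm; have [cY muY1 _] := Ymm.
have [x0 Xx0] := euclid_mm_nonempty _ _ _ _ Xmm.
have [y0 Yy0] := euclid_mm_nonempty _ _ _ _ Ymm.
have sub1 (S : set (vec R n)) s t :
    dcompact (@edist R n) S -> diam S <= 0 -> S s -> S t -> t = s.
  move=> cS S0 Ss St; have [d0 dE _ _] := edist_metric R n.
  apply/dE/eqP; rewrite eq_le d0 andbT.
  exact: le_trans (edist_le_diam _ _ _ _ _ cS St Ss) S0.
pose T (x : vec R n) : vec R n := (x : 'rV[R]_n) - x0 + y0.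
have iT : eisometry T.
  by move=> x y; rewrite !edistE /T opprD addrACA subrr addr0 opprB addrA subrK.
apply: (@le_trans _ _ (monge_cost_iso p T X muX muY `^ p^-1)%E).
  by apply: ereal_inf_lbound; exists T.
rewrite -(@poweR0r R p^-1) ?invr_eq0 ?gt_eqF//.
have cost0 : (0 <= monge_cost_iso p T X muX muY)%E.
  apply: le_ereal_inf_tmp => _ [phi [_ _ ->]].
  by apply: integral_ge0 => x _; rewrite lee_fin powR_ge0.
apply: le_poweR => //; first by rewrite invr_ge0 ltW.
apply: ereal_inf_lbound; exists (fun=> y0 : Rn R n); split => //.
  move=> B mB; have mY := measurable_mm _ _ _ _ Ymm.
  rewrite -(probability_full_setI _ _ _ muY _ _ mY mB muY1).
  have YE : Y = [set y0].
    by apply/seteqP; split=> [y Yy|y ->//]; exact: sub1 Yy0 Yy.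
  have [By0|nBy0] := pselect (B y0).
    rewrite (_ : _ @^-1` _ = setT) ?probability_setT; last by apply/seteqP; split.
    by rewrite -muY1; congr (muY _); rewrite YE; apply/seteqP; split=> [y ->|y []].
  rewrite (_ : _ @^-1` _ = set0) ?measure0; last by apply/seteqP; split.
  rewrite (_ : _ `&` _ = set0) ?measure0//.
  by rewrite YE; apply/seteqP; split=> [y [-> //]|y].
rewrite integral0_eq// => x Xx; rewrite (sub1 X x0 x)//.
rewrite /T subrr add0r.
have [_ /(_ y0 y0)[_ ->]// _ _] := edist_metric R n.
by rewrite powR0// gt_eqF.
Qed.

Theorem theorem3p3 (R : realType) (n : nat) :
  exists c : R,
  forall (X : set (vec R n)) (muX : probability (Rn R n) R)
         (Y : set (vec R n)) (muY : probability (Rn R n) R) (p : R),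
    euclid_mm X muX -> euclid_mm Y muY -> 1 <= p ->
    let M := Num.max (diam X) (diam Y) in
    (dGM_emb p X muX Y muY <= dM_iso p X muX Y muY)%E /\
    (dM_iso p X muX Y muY <=
       (Num.sqrt M * c)%:E * (dGM_emb p X muX Y muY `^ 2^-1))%E.
Proof.
have [C C0 monge] := monge_to_isometry R n.
exists C => X muX Y muY p Xmm Ymm p1 M.
split; first exact: dGM_emb_le_dM_iso.
have p0 : 0 < p by lra.
have [M0|M0] := leP M 0.
  apply: (@le_trans _ _ 0%E); first exact: dM_iso_singletons.
  apply: mule_ge0; last exact: poweR_ge0.
  by rewrite lee_fin mulr_ge0 ?sqrtr_ge0 ?ltW.
set K := Num.sqrt M * C.
have K0 : 0 < K by rewrite mulr_gt0// sqrtr_gt0.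
(* The infimum need not be attained, so the estimate is shown for every [e] above it; the strict
   inequality yields a space [Z] and a map of cost below [e]. *)
have step e : 0 < e -> (dGM_emb p X muX Y muY < e%:E)%E ->
    (dM_iso p X muX Y muY <= (K * Num.sqrt e)%:E)%E.
  move=> e0 /ereal_inf_lt[_ [Z [dZ [fX [fY [al [be [[mZ _] [isoX isoY] alE beE ->]]]]]]]].
  move=> /ereal_inf_lt[_ [phi [mphi push ->]] cost].
  have cost' : (\int[al]_z (dZ z (phi z) `^ p)%:E < (e `^ p)%:E)%E.
    rewrite ltNge; apply/negP => h; move: cost; apply/negP; rewrite -leNgt.
    have eE : (e%:E = (e%:E `^ p) `^ p^-1)%E by rewrite poweRK// lee_fin ltW.
    rewrite [leLHS]eE; apply: le_poweR; rewrite ?poweR_ge0 ?invr_ge0 ?(ltW p0)//.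
  have [T iT Tcost] := monge X muX Y muY p e Z dZ fX fY al be phi Xmm Ymm p1 e0
    M0 mZ isoX isoY alE beE mphi push cost'.
  apply: (@le_trans _ _ (monge_cost_iso p T X muX muY `^ p^-1)%E).
    by apply: ereal_inf_lbound; exists T.
  have Ke : (0 <= (K * Num.sqrt e)%:E)%E by rewrite lee_fin mulr_ge0 ?sqrtr_ge0 ?ltW.
  rewrite -[leRHS](poweRK _ _ _ Ke p0); apply: le_poweR.
  - by rewrite invr_ge0 ltW.
  - apply: le_ereal_inf_tmp => _ [psi [_ _ ->]].
    by apply: integral_ge0 => x _; rewrite lee_fin powR_ge0.
  - by rewrite /K (mulrC (Num.sqrt M)).
have := dGM_emb_ge0 R n X muX Y muY p.
move: step; case: (dGM_emb p X muX Y muY) => [r| |] step r0 //.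
  rewrite poweR_EFin powR12_sqrt -?lee_fin// -EFinM.
  apply/lee_addgt0Pr => e e0; rewrite -EFinD.
  have eK : 0 < e / K by rewrite divr_gt0.
  (* This excess is chosen so that [sqrt (r + (e / K)^2) <= sqrt r + e / K], which costs [e] after
     multiplication by [K]; it also covers [r = 0]. *)
  apply: le_trans (step (r + (e / K) ^+ 2) _ _) _.
  - by rewrite ltr_wpDl ?exprn_gt0 -?lee_fin.
  - by rewrite lte_fin ltrDl exprn_gt0.
  rewrite lee_fin -[X in _ <= _ + X](divfK (lt0r_neq0 K0)) [e / K * K]mulrC -mulrDr.
  rewrite ler_pM2l// -(@ler_pXn2r _ 2) ?nnegrE ?addr_ge0 ?sqrtr_ge0 ?(ltW eK)//.
  rewrite lee_fin in r0.
  rewrite sqr_sqrtr ?addr_ge0 ?sqr_ge0// sqrrD sqr_sqrtr//.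
  by rewrite addrAC lerDl mulrn_wge0// mulr_ge0 ?sqrtr_ge0 ?ltW.
(* If the embedding distance is infinite, so is the right-hand side, because [K > 0]. *)
by rewrite poweRyr ?invr_eq0// gt0_muley ?lte_fin// leey.
Qed.
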